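(* Let $M \xrightarrow{R} A$ be a relative Rota-Baxter algebra and $(N \xrightarrow{S} B, l, r)$ a bimodule over it. Then $N$ is a representation of the induced dendriform algebra $(M,\prec_R,\succ_R)$ with action maps given, for $m\in M$, $n\in N$, by $$m\prec n=l(m,S(n)),\quad m\succ n=R(m)\cdot_N n,\quad n\prec m=n\cdot_N R(m),\quad n\succ m=r(S(n),m).$$
   Context: All vector spaces and (multi)linear maps are over a field $\mathbf{k}$ of characteristic $0$. Associative algebras need not be unital. For an associative algebra $A$, an $A$-bimodule is a vector space $M$ with bilinear maps $A\otimes M\to M$, $(a,m)\mapsto a\cdot_M m$, and $M\otimes A\to M$, $(m,a)\mapsto m\cdot_M a$, with $(a\cdot a')\cdot_M m=a\cdot_M(a'\cdot_M m)$, $(a\cdot_M m)\cdot_M a'=a\cdot_M(m\cdot_M a')$, $(m\cdot_M a)\cdot_M a'=m\cdot_M(a\cdot a')$. A relative Rota-Baxter algebra $M\xrightarrow{R}A$ consists of an associative algebra $A$, an $A$-bimodule $M$ and a linear map $R:M\to A$ with $R(m)\cdot R(m')=R(R(m)\cdot_M m'+m\cdot_M R(m'))$ for all $m,m'\in M$. A bimodule over $M\xrightarrow{R}A$ is a tuple $(N\xrightarrow{S}B,l,r)$ in which $S:N\to B$ is a linear map ($2$-term chain complex), $B$ and $N$ are both $A$-bimodules, and $l:M\otimes B\to N$, $r:B\otimes M\to N$ are bilinear maps such that for all $a\in A,b\in B,m\in M,n\in N$: - $l(a\cdot_M m,b)=a\cdot_N l(m,b)$, $l(m\cdot_M a,b)=l(m,a\cdot_B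 b)$, $l(m,b\cdot_B a)=l(m,b)\cdot_N a$; - $r(a\cdot_B b,m)=a\cdot_N r(b,m)$, $r(b\cdot_B a,m)=r(b,a\cdot_M m)$, $r(b,m\cdot_M a)=r(b,m)\cdot_N a$; - $R(m)\cdot_B S(n)=S(R(m)\cdot_N n+l(m,S(n)))$, $S(n)\cdot_B R(m)=S(r(S(n),m)+n\cdot_N R(m))$. A dendriform algebra is a vector space $D$ with bilinear operations $\prec,\succ:D\otimes D\to D$ satisfying, for all $x,y,z\in D$: $(x\prec y)\prec z=x\prec(y\prec z+y\succ z)$; $(x\succ y)\prec z=x\succ(y\prec z)$; $(x\prec y+x\succ y)\succ z=x\succ(y\succ z)$. A representation of $D$ is a vector space $E$ with four bilinear maps $\prec,\succ:D\otimes E\to E$ and $\prec,\succ:E\otimes D\to E$ satisfying the nine identities obtained from these three by letting exactly one of $x,y,z$ be in $E$ and the other two in $D$. The induced dendriform algebra structure on $M$ of a relative Rota-Baxter algebra $M\xrightarrow{R}A$ is $m\prec_R m'=m\cdot_M R(m')$, $m\succ_R m'=R(m)\cdot_M m'$. *)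

(* Defs.v *)
From HB Require Import structures.
From mathcomp Require Import all_boot all_order all_algebra.

Set Implicit Arguments.
Unset Strict Implicit.
Unset Printing Implicit Defensive.

Import GRing.Theory.
Local Open Scope ring_scope.

(* The library's algebra structures are unital, so a possibly non-unital
   associative algebra is a vector space with an associative bilinear product. *)
Record assocAlg (K : fieldType) := AssocAlg {
  alg_sort :> lmodType K;
  alg_mul : {bilinear alg_sort -> alg_sort -> alg_sort};
  alg_mulA : forall a b c, alg_mul (alg_mul a b) c = alg_mul a (alg_mul b c)
}.

Arguments alg_mul {K A} : rename.

Record bimodule (K : fieldType) (A : assocAlg K) := Bimodule {
  bimod_sort :> lmodType K;
  lact : {bilinear A -> bimod_sort -> bimod_sort};
  ract : {bilinear bimod_sort -> A -> bimod_sort};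
  lact_mul : forall a a' m, lact (alg_mul a a') m = lact a (lact a' m);
  lract : forall a m a', ract (lact a m) a' = lact a (ract m a');
  ract_mul : forall m a a', ract (ract m a) a' = ract m (alg_mul a a')
}.

Arguments lact {K A M} : rename.
Arguments ract {K A M} : rename.

(* The relative Rota-Baxter algebra R : M -> A. *)
Record relRBAlg (K : fieldType) := RelRBAlg {
  rb_alg : assocAlg K;
  rb_mod : bimodule rb_alg;
  rb_op : {linear rb_mod -> rb_alg};
  rb_opM : forall m m',
    alg_mul (rb_op m) (rb_op m') =
      rb_op (lact (rb_op m) m' + ract m (rb_op m'))
}.

(* The bimodule (S : N -> B, l, r) over T = (R : M -> A). *)
Record rbBimodule (K : fieldType) (T : relRBAlg K) := RBBimodule {
  rbm_src : bimodule (rb_alg T);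
  rbm_tgt : bimodule (rb_alg T);
  rbm_map : {linear rbm_src -> rbm_tgt};
  rbm_l : {bilinear rb_mod T -> rbm_tgt -> rbm_src};
  rbm_r : {bilinear rbm_tgt -> rb_mod T -> rbm_src};
  rbm_l_lactm : forall a m b, rbm_l (lact a m) b = lact a (rbm_l m b);
  rbm_l_ractm : forall m a b, rbm_l (ract m a) b = rbm_l m (lact a b);
  rbm_l_ractb : forall m b a, rbm_l m (ract b a) = ract (rbm_l m b) a;
  rbm_r_lactb : forall a b m, rbm_r (lact a b) m = lact a (rbm_r b m);
  rbm_r_ractb : forall b a m, rbm_r (ract b a) m = rbm_r b (lact a m);
  rbm_r_ractm : forall b m a, rbm_r b (ract m a) = ract (rbm_r b m) a;
  rbm_map_lact : forall m n,
    lact (rb_op T m) (rbm_map n) =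
      rbm_map (lact (rb_op T m) n + rbm_l m (rbm_map n));
  rbm_map_ract : forall n m,
    ract (rbm_map n) (rb_op T m) =
      rbm_map (rbm_r (rbm_map n) m + ract n (rb_op T m))
}.

Record dendriform (K : fieldType) := Dendriform {
  dend_sort :> lmodType K;
  dprec : {bilinear dend_sort -> dend_sort -> dend_sort};
  dsucc : {bilinear dend_sort -> dend_sort -> dend_sort};
  dprecA : forall x y z,
    dprec (dprec x y) z = dprec x (dprec y z + dsucc y z);
  dsuccprecA : forall x y z, dprec (dsucc x y) z = dsucc x (dprec y z);
  dsuccA : forall x y z,
    dsucc (dprec x y + dsucc x y) z = dsucc x (dsucc y z)
}.

Arguments dprec {K D} : rename.
Arguments dsucc {K D} : rename.

(* lprec x e = x < e, lsucc x e = x > e, rprec e x = e < x, rsucc e x = e > x;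
   in the field names, the last digit is the position of the argument in E. *)
Record dend_representation (K : fieldType) (D : dendriform K) (E : lmodType K)
    (lprec lsucc : D -> E -> E) (rprec rsucc : E -> D -> E) : Prop :=
  DendRepresentation {
  rep_lprec_bilinear : bilinear_for *:%R *:%R lprec;
  rep_lsucc_bilinear : bilinear_for *:%R *:%R lsucc;
  rep_rprec_bilinear : bilinear_for *:%R *:%R rprec;
  rep_rsucc_bilinear : bilinear_for *:%R *:%R rsucc;
  rep_prec1 : forall e y z,
    rprec (rprec e y) z = rprec e (dprec y z + dsucc y z);
  rep_prec2 : forall x e z,
    rprec (lprec x e) z = lprec x (rprec e z + rsucc e z);
  rep_prec3 : forall x y e,
    lprec (dprec x y) e = lprec x (lprec y e + lsucc y e);
  rep_succprec1 : forall e y z, rprec (rsucc e y) z = rsucc e (dprec y z);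
  rep_succprec2 : forall x e z, rprec (lsucc x e) z = lsucc x (rprec e z);
  rep_succprec3 : forall x y e, lprec (dsucc x y) e = lsucc x (lprec y e);
  rep_succ1 : forall e y z,
    rsucc (rprec e y + rsucc e y) z = rsucc e (dsucc y z);
  rep_succ2 : forall x e z,
    rsucc (lprec x e + lsucc x e) z = lsucc x (rsucc e z);
  rep_succ3 : forall x y e,
    lsucc (dprec x y + dsucc x y) e = lsucc x (lsucc y e)
}.

Section InducedDendriform.
Variables (K : fieldType) (T : relRBAlg K).

Definition rb_prec (m m' : rb_mod T) : rb_mod T := ract m (rb_op T m').
Definition rb_succ (m m' : rb_mod T) : rb_mod T := lact (rb_op T m) m'.

Lemma rb_prec_is_bilinear : bilinear_for *:%R *:%R rb_prec.
Proof.
by split=> m k x y; rewrite /rb_prec ?linearPl // linearP linearPr.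
Qed.

Lemma rb_succ_is_bilinear : bilinear_for *:%R *:%R rb_succ.
Proof.
by split=> m k x y; rewrite /rb_succ ?linearPr // linearP linearPl.
Qed.

HB.instance Definition _ :=
  bilinear_isBilinear.Build K (rb_mod T) (rb_mod T) (rb_mod T) *:%R *:%R
    rb_prec rb_prec_is_bilinear.

HB.instance Definition _ :=
  bilinear_isBilinear.Build K (rb_mod T) (rb_mod T) (rb_mod T) *:%R *:%R
    rb_succ rb_succ_is_bilinear.

Lemma rb_precA x y z :
  rb_prec (rb_prec x y) z = rb_prec x (rb_prec y z + rb_succ y z).
Proof. by rewrite /rb_prec /rb_succ ract_mul rb_opM addrC. Qed.

Lemma rb_succprecA x y z : rb_prec (rb_succ x y) z = rb_succ x (rb_prec y z).
Proof. exact: lract. Qed.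

Lemma rb_succA x y z :
  rb_succ (rb_prec x y + rb_succ x y) z = rb_succ x (rb_succ y z).
Proof. by rewrite /rb_prec /rb_succ -lact_mul rb_opM addrC. Qed.

Definition induced_dendriform : dendriform K :=
  @Dendriform K (rb_mod T) rb_prec rb_succ rb_precA rb_succprecA rb_succA.

End InducedDendriform.

(* Main.v *)
Require Import Defs.
From mathcomp Require Import all_boot all_order all_algebra.

Set Implicit Arguments.
Unset Strict Implicit.
Unset Printing Implicit Defensive.

Import GRing.Theory.
Local Open Scope ring_scope.

(** [R] sends a sum [y < z + y > z] in M to a product in A; likewise [S] sends such a sum with one
    argument in N to the action of [R] of the other on [S] of it. Each axiom containing a sum thus
    becomes an associativity or compatibility law of the actions, [l] or [r]. *)

Theorem proposition3p10 (K : fieldType) (charK0 : [pchar K] =i pred0)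
    (T : relRBAlg K) (X : rbBimodule T) :
  dend_representation (D := induced_dendriform T) (E := rbm_src X)
    (fun m n => rbm_l X m (rbm_map X n))
    (fun m n => lact (rb_op T m) n)
    (fun n m => ract n (rb_op T m))
    (fun n m => rbm_r X (rbm_map X n) m).
Proof.
split; rewrite /= /rb_prec /rb_succ.
- by split=> u k x y /=; rewrite ?linearP // linearPl.
- by split=> u k x y /=; rewrite ?linearPr // linearP linearPl.
- by split=> u k x y /=; rewrite ?linearPl // linearP linearPr.
- by split=> u k x y /=; rewrite ?linearPr // linearP linearPl.
- by move=> e y z; rewrite ract_mul rb_opM addrC.
(* With [e] in the sum, the Rota-Baxter identity of [R] gives way to its analogue for [S]. *)
- by move=> x e z; rewrite -rbm_l_ractb rbm_map_ract addrC.
- by move=> x y e; rewrite rbm_l_ractm rbm_map_lact addrC.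
(* The middle axioms contain no sum: each is one compatibility law. *)
- by move=> e y z; rewrite rbm_r_ractm.
- by move=> x e z; rewrite lract.
- by move=> x y e; rewrite rbm_l_lactm.
(* The sum is now on the left, so it is collapsed before the action law applies. *)
- by move=> e y z; rewrite addrC -rbm_map_ract rbm_r_ractb.
- by move=> x e z; rewrite addrC -rbm_map_lact rbm_r_lactb.
- by move=> x y e; rewrite addrC -rb_opM lact_mul.
Qed.
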